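(* Let $g\geq 1$ be an integer and $\rho:=2g-2$. Let $\lambda$ be a non-zero partition, written as $\lambda=(1^{m_1}2^{m_2}\cdots N^{m_N})$ with $N$ the largest part of $\lambda$, and let $m=(m_1,m_2,\ldots)$ be its sequence of multiplicities ($m_i=0$ for $i>N$). Then $$ A_\lambda(1)=\frac1\rho\sum_{d\mid m}\frac{\mu(d)}{d^2}\, \frac1{P_1(m/d)\,P_N(m/d)}\prod_{i\geq 1}\binom{\rho\, P_i(m/d)-1+m_i/d}{m_i/d}, $$ where the sum runs over the positive integers $d$ dividing all the $m_i$, $m/d:=(m_1/d,m_2/d,\ldots)$, $\mu$ is the Möbius function, and $P_i(m):=\sum_{j\geq 1}\min(i,j)\,m_j$.
   Context: Fix an integer $g\ge 1$. For a finite sequence $m=(m_1,\ldots,m_N)$ of non-negative integers and variables $x=(x_1,\ldots,x_N)$ put $x^m:=x_1^{m_1}\cdots x_N^{m_N}$, $(q)_n:=\prod_{k=1}^n(1-q^k)$ (so $(q^{-1})_n=\prod_{k=1}^n(1-q^{-k})$), and $(q^{-1})_m:=\prod_{i=1}^N (q^{-1})_{m_i}$. Let $\mathcal H_N$ be the $N\times N$ matrix with entries $\min(i,j)$, $1\le i,j\le N$. Define $$ \mathrm{Hua}_N(x;q):=\sum_{m\in\mathbb Z_{\ge0}^N}\frac{q^{(g-1)\,{}^tm\mathcal H_N m}}{(q^{-1})_m}\,x^m\in 1+(x_1,\dots,x_N)\,\mathbb Q(q)[[x_1,\ldots,x_N]]. $$ $\mathrm{Log}$ denotes the plethystic logarithm: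 for a power series $F$ over $\mathbb Q(q)$ with constant term $1$, $\mathrm{Log}(F):=\sum_{k\ge1}\frac{\mu(k)}{k}\,\psi_k(\log F)$, where $\psi_k$ replaces $q$ by $q^k$ and each $x_i$ by $x_i^k$; it takes products to sums and sends $(1-w)^{-1}$ to $w$ for a non-constant monomial $w$. The rational functions $A_m(q)\in\mathbb Q(q)$ are defined by $$ (q-1)\,\mathrm{Log}\big(\mathrm{Hua}_N(x;q)\big)=\sum_m A_m(q)\,x^m . $$ For a partition $\lambda=(1^{m_1}2^{m_2}\cdots N^{m_N})$ (i.e. $\lambda$ has exactly $m_i$ parts equal to $i$, and all parts are $\le N$) set $A_\lambda(q):=A_m(q)$, with $m=(m_1,\ldots,m_N)$; this does not depend on the choice of $N\ge\lambda_1$, where $\lambda_1$ is the largest part. $A_\lambda(1)$ is the value of the rational function $A_\lambda(q)$ at $q=1$. Binomial coefficients are $\binom{y}{k}=y(y-1)\cdots(y-k+1)/k!$, $\binom y0=1$. Each product on the right-hand side of the formula is, as a polynomial in $\rho$, divisible by $\rho$; when $\rho=0$ (i.e. $g=1$) the right-hand side is understood as the value at $\rho=0$ of the resulting polynomial in $\rho$. *)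

(* Defs.v *)
From HB Require Import structures.
From mathcomp Require Import all_boot all_order all_algebra.
From mathcomp Require Import generic_quotient.
From mathcomp Require Import mpoly.

Set Implicit Arguments.
Unset Strict Implicit.
Unset Printing Implicit Defensive.

Import GRing.Theory Num.Theory.
Local Open Scope ring_scope.

Definition moebius (n : nat) : int :=
  if all (fun p => logn p n == 1%N) (primes n)
  then (-1) ^+ size (primes n) else 0.

Notation Qq := {fraction {poly rat}}.

Definition polyQq (p : {poly rat}) : Qq := FracField.tofrac p.

Definition qX : Qq := polyQq 'X.

(* The substitution q := q^k.  It is computed on the representative chosen by
   [repr], which need not be in lowest terms; [subst_qE] below shows that for
   k > 0 the choice is irrelevant. *)
Definition subst_q (k : nat) (f : Qq) : Qq :=
  polyQq (\n_(repr f) \Po 'X^k) / polyQq (\d_(repr f) \Po 'X^k).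

(* f is regular at a and takes there the value v. *)
Definition has_value (f : Qq) (a v : rat) : Prop :=
  exists n d : {poly rat},
    [/\ d.[a] != 0, f = polyQq n / polyQq d & v = n.[a] / d.[a]].

(* A power series is the function giving its coefficients.  The ordinal
   i : 'I_N stands for the variable x_(i+1). *)
Definition fps (N : nat) := 'X_{1..N} -> Qq.

Definition mnm_dvd (N d : nat) (m : 'X_{1..N}) : bool :=
  [forall i, (d %| m i)%N].

Definition mnm_div (N : nat) (m : 'X_{1..N}) (d : nat) : 'X_{1..N} :=
  [multinom (m i %/ d)%N | i < N].

Definition fps_one N : fps N := fun m => (m == 0%MM)%:R.

Definition fps_sub N (F G : fps N) : fps N := fun m => F m - G m.

Definition fps_mul N (F G : fps N) : fps N := fun m =>
  \sum_(k : 'X_{1..N < (mdeg m).+1} | (k <= m)%MM) F k * G (m - k)%MM.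

Definition fps_pow N (F : fps N) (k : nat) : fps N :=
  iter k (fps_mul F) (@fps_one N).

(* log F = \sum_(k >= 1) (-1)^(k-1)/k (F - 1)^k for F with constant term 1.
   The terms with k > mdeg m do not contribute to the coefficient of x^m
   ([fps_pow_small]). *)
Definition fps_log N (F : fps N) : fps N := fun m =>
  \sum_(1 <= k < (mdeg m).+1)
    (-1) ^+ k.-1 / k%:R * fps_pow (fps_sub F (@fps_one N)) k m.

(* q := q^k and x_i := x_i^k. *)
Definition fps_psi N (k : nat) (F : fps N) : fps N := fun m =>
  if mnm_dvd k m then subst_q k (F (mnm_div m k)) else 0.

(* For m != 0 only the k dividing m contribute to the coefficient of x^m, so
   that the sum may be stopped at mdeg m; the constant term is 0. *)
Definition fps_Log N (F : fps N) : fps N := fun m =>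
  \sum_(1 <= k < (mdeg m).+1)
    (moebius k)%:~R / k%:R * fps_psi k (fps_log F) m.

Definition qpoch (t : Qq) (n : nat) : Qq := \prod_(1 <= k < n.+1) (1 - t ^+ k).

Definition quad_form N (m : 'X_{1..N}) : nat :=
  (\sum_(i < N) \sum_(j < N) m i * minn i.+1 j.+1 * m j)%N.

(* Only used for g >= 1, so that g - 1 is not truncated. *)
Definition Hua (g N : nat) : fps N := fun m =>
  qX ^+ ((g - 1) * quad_form m) / \prod_(i < N) qpoch qX^-1 (m i).

Definition A_mnm (g N : nat) (m : 'X_{1..N}) : Qq :=
  (qX - 1) * fps_Log (@Hua g N) m.

Definition is_partition (la : seq nat) : bool :=
  sorted geq la && (0%N \notin la).

Definition largest_part (la : seq nat) : nat := head 0%N la.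

Definition multiplicities (la : seq nat) : 'X_{1..largest_part la} :=
  [multinom count_mem i.+1 la | i < largest_part la].

Definition A_part (g : nat) (la : seq nat) : Qq := A_mnm g (multiplicities la).

Definition P_ N (i : nat) (m : 'X_{1..N}) : nat :=
  (\sum_(j < N) minn i j.+1 * m j)%N.

(* Used both for R = rat and for R = {poly rat}, where k! is a unit. *)
Definition gbinom (R : unitRingType) (y : R) (k : nat) : R :=
  (\prod_(j < k) (y - j%:R)) / (k`!)%:R.

(* The factors with i > N of the product over all i >= 1 are equal to 1. *)
Definition binom_prod (R : unitRingType) N (rho : R) (m : 'X_{1..N}) : R :=
  \prod_(i < N) gbinom (rho * (P_ i.+1 m)%:R - 1 + (m i)%:R) (m i).

Definition weight N (m : 'X_{1..N}) (d : nat) : rat :=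
  (moebius d)%:~R / d%:R ^+ 2
    * (1 / ((P_ 1 (mnm_div m d))%:R * (P_ N (mnm_div m d))%:R)).

(* The right-hand side as a polynomial in the indeterminate rho = 'X; the
   division by 'X is exact for m != 0 ([dvdX_binom_prod]). *)
Definition rhs_poly N (m : 'X_{1..N}) : {poly rat} :=
  \sum_(1 <= d < (mdeg m).+1 | mnm_dvd d m)
    weight m d *: (binom_prod 'X (mnm_div m d) %/ 'X).

(* For m != 0 every d dividing m satisfies d <= mdeg m. *)
Definition rhs N (rho : rat) (m : 'X_{1..N}) : rat :=
  if rho == 0 then (rhs_poly m).[0]
  else rho^-1 * \sum_(1 <= d < (mdeg m).+1 | mnm_dvd d m)
                  weight m d * binom_prod rho (mnm_div m d).

Lemma polyQq_eq0 p : (polyQq p == 0) = (p == 0).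
Proof. exact: tofrac_eq0. Qed.

Lemma polyQq_eq p r : (polyQq p == polyQq r) = (p == r).
Proof. exact: tofrac_eq. Qed.

Lemma polyQqM p r : polyQq (p * r) = polyQq p * polyQq r.
Proof. exact: tofracM. Qed.

Lemma comp_Xn_eq0 (p : {poly rat}) k :
  (0 < k)%N -> (p \Po 'X^k == 0) = (p == 0).
Proof.
by move=> k_gt0; apply: comp_poly_eq0; rewrite size_polyXn.
Qed.

Lemma Qq_numden (f : Qq) : f = polyQq \n_(repr f) / polyQq \d_(repr f).
Proof.
have d0 := denom_ratioP (repr f).
apply: (canRL (mulfK _)); first by rewrite polyQq_eq0.
rewrite -{1}[f]reprK /polyQq; unlock FracField.tofrac.
rewrite -[LHS]FracField.pi_mul; apply/eqmodP; rewrite /= FracField.equivfE.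
by rewrite /FracField.mulf !numden_Ratio ?mulr1 ?mul1r ?oner_neq0 // mulrC.
Qed.

Lemma subst_qE k (n d : {poly rat}) : (0 < k)%N -> d != 0 ->
  subst_q k (polyQq n / polyQq d) = polyQq (n \Po 'X^k) / polyQq (d \Po 'X^k).
Proof.
move=> k_gt0 d0; rewrite /subst_q; set f := polyQq n / _.
have r0 : \d_(repr f) != 0 by exact: denom_ratioP.
have : f == polyQq \n_(repr f) / polyQq \d_(repr f) by rewrite -Qq_numden.
rewrite {1}/f eqr_div ?polyQq_eq0 // -!polyQqM polyQq_eq => /eqP e.
apply/eqP; rewrite eqr_div ?polyQq_eq0 ?comp_Xn_eq0 // -!polyQqM polyQq_eq.
by rewrite -!comp_polyM -e.
Qed.

Lemma has_value_uniq f a v w : has_value f a v -> has_value f a w -> v = w.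
Proof.
move=> [n [d [d0 -> ->]]] [n' [d' [d'0 e ->]]].
have nz (p : {poly rat}) : p.[a] != 0 -> p != 0.
  by apply: contraNneq => ->; rewrite horner0.
move/eqP: e; rewrite eqr_div ?polyQq_eq0 ?nz // -!polyQqM polyQq_eq => /eqP e.
by apply/eqP; rewrite eqr_div // -!hornerM e.
Qed.

Lemma fps_pow_small N (F : fps N) k m :
  F 0%MM = 0 -> (mdeg m < k)%N -> fps_pow F k m = 0.
Proof.
move=> F0; elim: k m => [//|k IHk] m lt_mk.
rewrite /fps_pow iterS -/(fps_pow F k) /fps_mul big1 // => -[h /= hb] le_hm.
have [->|h0] := eqVneq h 0%MM; first by rewrite F0 mul0r.
rewrite IHk ?mulr0 // -ltnS; apply: leq_trans lt_mk.
rewrite ltnS -[in X in (_ < X)%N](submK le_hm) mdegD -[X in (X < _)%N]addn0.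
by rewrite ltn_add2l lt0n mdeg_eq0.
Qed.

Lemma Hua0 g N : @Hua g N 0%MM = 1.
Proof.
rewrite /Hua /quad_form big1 => [|i _]; last first.
  by rewrite big1 // => j _; rewrite mnm0E.
rewrite muln0 expr0 big1 ?divr1 // => i _.
by rewrite mnm0E /qpoch big_geq.
Qed.

Lemma mnm_dvd_le N d (m : 'X_{1..N}) :
  m != 0%MM -> mnm_dvd d m -> (d <= mdeg m)%N.
Proof.
move=> m0 /forallP dvd; apply: dvdn_leq; first by rewrite lt0n mdeg_eq0.
by rewrite mdegE; apply: dvdn_sum => i _.
Qed.

Lemma dvdX_binom_prod N (m : 'X_{1..N}) :
  m != 0%MM -> 'X %| binom_prod ('X : {poly rat}) m.
Proof.
move=> m0; have [i mi] : exists i, (0 < m i)%N.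
  apply/existsP; apply: contraR m0 => /existsPn mi.
  by apply/eqP/mnmP => i; apply/eqP; rewrite mnm0E -leqn0 leqNgt.
rewrite /binom_prod (bigD1 i) //= dvdp_mulr // /gbinom dvdp_mulr //.
have lt : ((m i).-1 < m i)%N by rewrite prednK.
rewrite (bigD1 (Ordinal lt)) //= dvdp_mulr //.
have -> : (m i)%:R = (m i).-1%:R + 1 :> {poly rat}.
  by rewrite natr1 prednK.
have -> (x a : {poly rat}) : x - 1 + (a + 1) - a = x.
  by rewrite [a + 1]addrC addrA subrK addrK.
by rewrite dvdp_mulr.
Qed.

Lemma horner_binom_prod N (m : 'X_{1..N}) (rho : rat) :
  (binom_prod 'X m).[rho] = binom_prod rho m.
Proof.
rewrite /binom_prod horner_prod; apply: eq_bigr => i _; rewrite /gbinom.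
have nat_polyC n : n%:R = (n%:R : rat)%:P by rewrite polyC_natr.
rewrite !nat_polyC polyCV hornerM hornerC horner_prod; congr (_ * _).
by apply: eq_bigr => j _; rewrite nat_polyC !hornerE.
Qed.

Lemma rhs_polyE N (m : 'X_{1..N}) (rho : rat) :
  m != 0%MM -> (rhs_poly m).[rho] = rhs rho m.
Proof.
move=> m0; rewrite /rhs; case: eqVneq => [-> //|rho0].
rewrite /rhs_poly horner_sum mulr_sumr; apply: eq_bigr => d dvd_dm.
rewrite hornerZ mulrCA; congr (_ * _); apply: (canRL (mulKf rho0)).
have md0 : mnm_div m d != 0%MM.
  apply: contra_neq m0 => e; apply/mnmP => i; move/forallP: dvd_dm => /(_ i).
  by move/divnK <-; move/mnmP: e => /(_ i); rewrite !mnmE => ->.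
rewrite -horner_binom_prod -{2}(divpK (dvdX_binom_prod md0)).
by rewrite hornerM hornerX mulrC.
Qed.

(* Main.v *)
(* Put R_a := Hua(q^a x) / Hua(x).  The quadratic form turns the q-difference
   equations of Hua into a recursion for the family R_a, which shows that the
   coefficients of R_a are regular at q = 1, and that their values form series
   r_a satisfying r_(b+e_i) = r_b + x_i r_(b+e_i+rho h_i), h_i = (min(i,j))_j.
   Comparing logarithmic derivatives, log Hua has a simple pole at q = 1, with
   residue B, and D_k r_a = r_a sum_j a_j D_k D_j B where D_k = x_k d/dx_k; the
   operators psi_k reduce the theorem to the formula for the coefficients of B.

   The series G_a of products of binomial coefficients binom(rho P_j(m) + a_j
   - 1 + m_j, m_j) satisfies the same recursion, so that G_a = r_a G_0.  Write
   G_0 = 1 + rho Q and theta = sum_k D_k.  Both Q and W := theta sum_j j D_j B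
   solve theta Y = (1 + rho Y) K for the same series K without constant term;
   hence W = Q, which is the formula for B divided by rho and thus also makes
   sense at rho = 0. *)
From HB Require Import structures.
From mathcomp Require Import all_boot all_order all_algebra.
From mathcomp Require Import boolp mpoly zify ring.
Require Import Defs.

Set Implicit Arguments.
Unset Strict Implicit.
Unset Printing Implicit Defensive.

Import GRing.Theory Num.Theory.
Local Open Scope ring_scope.

(** * Power series in several variables *)

(** A named copy of the function type, so that its ring product can be convolution; for [R := Qq] it
    is convertible with [fps N]. *)
Definition series (N : nat) (R : Type) : Type := 'X_{1..N} -> R.

HB.instance Definition _ N R := gen_eqMixin (series N R).
HB.instance Definition _ N R := gen_choiceMixin (series N R).

Section SeriesRing.
Variables (N : nat) (R : comNzRingType).
Implicit Types (F G K : series N R) (m : 'X_{1..N}).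

Definition series_mul F G : series N R := fun m =>
  \sum_(k : 'X_{1..N < (mdeg m).+1} | (k <= m)%MM) F k * G (m - k)%MM.

Definition trunc (n : nat) F : {mpoly R[N]} :=
  \sum_(m : 'X_{1..N < n}) F m *: 'X_[m].

Lemma coef_trunc n F m : (mdeg m < n)%N -> (trunc n F)@_m = F m.
Proof. by move=> lt_mn; rewrite /trunc mcoeff_mpoly. Qed.

(* Products of series are computed on truncations, so that the ring axioms
   come from those of [{mpoly R[N]}]. *)
Lemma series_mulE n (p q : {mpoly R[N]}) F G :
    (forall m, (mdeg m < n)%N -> p@_m = F m) ->
    (forall m, (mdeg m < n)%N -> q@_m = G m) ->
  forall m, (mdeg m < n)%N -> (p * q)@_m = series_mul F G m.
Proof.
move=> pF qG m lt_mn; rewrite [LHS](mcoeff_poly_mul_lin p q (k := (mdeg m).+1)) //.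
apply: eq_bigr => k _; rewrite pF ?qG //; last first.
  by apply: leq_trans (bmdeg k) lt_mn.
by apply: leq_ltn_trans lt_mn; apply: mdegB.
Qed.

Definition series_add F G : series N R := fun m => F m + G m.
Definition series_opp F : series N R := fun m => - F m.
Definition series_zero : series N R := fun=> 0.

Lemma series_addA : associative series_add.
Proof. by move=> F G K; apply/funext => m; apply: addrA. Qed.

Lemma series_addC : commutative series_add.
Proof. by move=> F G; apply/funext => m; apply: addrC. Qed.

Lemma series_add0 : left_id series_zero series_add.
Proof. by move=> F; apply/funext => m; apply: add0r. Qed.

Lemma series_addN : left_inverse series_zero series_opp series_add.
Proof. by move=> F; apply/funext => m; apply: addNr. Qed.

HB.instance Definition _ :=
  GRing.isZmodule.Build (series N R) series_addA series_addC series_add0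
    series_addN.

Lemma seriesDE F G m : (F + G) m = F m + G m. Proof. by []. Qed.
Lemma seriesNE F m : (- F) m = - F m. Proof. by []. Qed.
Lemma seriesBE F G m : (F - G) m = F m - G m. Proof. by []. Qed.
Lemma series0E m : (0 : series N R) m = 0. Proof. by []. Qed.

Definition series_one : series N R := fun m => (m == 0%MM)%:R.

Lemma series_mulA : associative series_mul.
Proof.
move=> F G K; apply/funext => m; set n := (mdeg m).+1.
have tr := @coef_trunc n.
rewrite -(series_mulE (p := trunc n F) (q := trunc n G * trunc n K) (n := n)) //;
  [|exact: tr|by apply: series_mulE; apply: tr].
rewrite mulrA; apply: series_mulE (ltnSn _); last exact: tr.
by apply: series_mulE; apply: tr.
Qed.

Lemma series_mulC : commutative series_mul.
Proof.
move=> F G; apply/funext => m; set n := (mdeg m).+1.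
have tr := @coef_trunc n.
rewrite -(series_mulE (p := trunc n F) (q := trunc n G) (n := n)) // 1?mulrC;
  try exact: tr.
by apply: series_mulE (ltnSn _); apply: tr.
Qed.

Lemma series_mul1 : left_id series_one series_mul.
Proof.
move=> F; apply/funext => m; set n := (mdeg m).+1.
have tr := @coef_trunc n.
rewrite -(series_mulE (p := 1) (q := trunc n F) (n := n)) //; first last.
- exact: tr.
- by move=> k _; rewrite mcoeff1 /series_one eq_sym.
by rewrite mul1r tr.
Qed.

Lemma series_mulDl : left_distributive series_mul +%R.
Proof.
move=> F G K; apply/funext => m; rewrite seriesDE /series_mul -big_split /=.
by apply: eq_bigr => k _; rewrite mulrDl.
Qed.

Lemma series_one_neq0 : series_one != 0.
Proof.
apply/eqP => /(congr1 (fun F : series N R => F 0%MM)) /eqP.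
by rewrite series0E /series_one eqxx oner_eq0.
Qed.

HB.instance Definition _ :=
  GRing.Zmodule_isComNzRing.Build (series N R) series_mulA series_mulC
    series_mul1 series_mulDl series_one_neq0.

Lemma seriesME F G m : (F * G) m =
  \sum_(k : 'X_{1..N < (mdeg m).+1} | (k <= m)%MM) F k * G (m - k)%MM.
Proof. by []. Qed.

Lemma series1E m : (1 : series N R) m = (m == 0%MM)%:R.
Proof. by []. Qed.

Lemma series_sumE (I : Type) (r : seq I) (P : pred I) (E : I -> series N R) m :
  (\sum_(i <- r | P i) E i) m = \sum_(i <- r | P i) E i m.
Proof. exact: (big_morph (fun F : series N R => F m)). Qed.

Lemma seriesMnE F n m : (F *+ n) m = F m *+ n.
Proof. by elim: n => [|n IH]; rewrite ?mulr0n // !mulrS seriesDE IH. Qed.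

Lemma coef0M F G : (F * G) 0%MM = F 0%MM * G 0%MM.
Proof.
pose z := BMultinom (ltnSn (mdeg (0%MM : 'X_{1..N}))).
rewrite seriesME (bigD1 z) ?lepm_refl //=.
rewrite subm0 big1 ?addr0 // => k /andP[/mnm_lepP k0 /eqP nk].
by case: nk; apply/val_inj/mnmP => i; apply/eqP; move: (k0 i); rewrite mnm0E leqn0.
Qed.

Definition monom (u : 'X_{1..N}) : series N R := fun m => (m == u)%:R.

Lemma coef_monomM u F m :
  (monom u * F) m = if (u <= m)%MM then F (m - u)%MM else 0.
Proof.
rewrite seriesME; case: ifPn => [le_um|nle_um].
  have lt : (mdeg u < (mdeg m).+1)%N by rewrite ltnS -(submK le_um) mdegD leq_addl.
  rewrite (bigD1 (BMultinom lt)) //= /monom eqxx mul1r big1 ?addr0 // => k.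
  case/andP=> _ /eqP ne; case: eqP => [e|_]; last by rewrite mul0r.
  by case: ne; apply: val_inj.
rewrite big1 // => k le_km; rewrite /monom; case: eqP => [e|_]; last by rewrite mul0r.
by rewrite -e le_km in nle_um.
Qed.

End SeriesRing.

(** * Orders, derivations, inverses and substitutions *)

Section SeriesTheory.
Variables (N : nat) (R : comNzRingType).
Implicit Types (F G X Y : series N R) (m u a : 'X_{1..N}).

(** Replaces the adic topology: identities between infinite sums are proved modulo every degree and
    concluded by [has_order_eq0]. *)
Definition has_order n F := forall m, (mdeg m < n)%N -> F m = 0.

Lemma has_order_eq0 F : (forall n, has_order n F) -> F = 0.
Proof. by move=> F0; apply/funext => m; apply: (F0 (mdeg m).+1). Qed.

Lemma has_order1 F : F 0%MM = 0 -> has_order 1 F.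
Proof. by move=> F0 m; rewrite ltnS leqn0 mdeg_eq0 => /eqP->. Qed.

Lemma has_orderD n F G : has_order n F -> has_order n G -> has_order n (F + G).
Proof. by move=> F0 G0 m lt_mn; rewrite seriesDE F0 // G0 // addr0. Qed.

Lemma has_orderN n F : has_order n F -> has_order n (- F).
Proof. by move=> F0 m lt_mn; rewrite seriesNE F0 // oppr0. Qed.

Lemma has_orderM i j F G :
  has_order i F -> has_order j G -> has_order (i + j) (F * G).
Proof.
move=> F0 G0 m lt_m; rewrite seriesME big1 // => k le_km.
have [lt_ki|le_ik] := ltnP (mdeg k) i; first by rewrite F0 ?mul0r.
rewrite G0 ?mulr0 // -(ltn_add2l i); apply: leq_ltn_trans lt_m.
by rewrite -[in leqRHS](submK le_km) mdegD addnC leq_add2l.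
Qed.

Lemma has_order_mull n F G : has_order n G -> has_order n (F * G).
Proof. by move=> G0; apply: (@has_orderM 0). Qed.

Lemma has_orderX n F : has_order 1 F -> has_order n (F ^+ n).
Proof.
by move=> F0; elim: n => [//|n IH]; rewrite exprS -add1n; apply: has_orderM.
Qed.

Definition D (k : 'I_N) F : series N R := fun m => (m k)%:R * F m.

Lemma DE k F m : D k F m = (m k)%:R * F m. Proof. by []. Qed.

Lemma D_is_additive k : {morph D k : F G / F - G}.
Proof. by move=> F G; apply/funext => m; rewrite !(seriesBE, DE) mulrBr. Qed.

HB.instance Definition _ k :=
  GRing.isZmodMorphism.Build (series N R) (series N R) (D k) (@D_is_additive k).

Lemma DM k F G : D k (F * G) = D k F * G + F * D k G.
Proof.
apply/funext => m; rewrite DE !(seriesDE, seriesME) mulr_sumr -big_split /=.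
apply: eq_bigr => u le_um; rewrite !DE -{1}(submK le_um) mnmDE natrD.
by ring.
Qed.

Lemma D1 k : D k 1 = 0.
Proof.
apply/funext => m; rewrite DE series1E.
by case: eqP => [->|_]; rewrite ?mulr0 // mnm0E mul0r.
Qed.

Lemma DX k F n : D k (F ^+ n.+1) = F ^+ n * D k F *+ n.+1.
Proof.
elim: n => [|n IH]; first by rewrite expr1 expr0 mul1r.
by rewrite exprS DM IH mulrSr exprS; ring.
Qed.

Lemma D_monom k u : D k (monom R u) = monom R u *+ u k.
Proof.
apply/funext => m; rewrite DE seriesMnE /monom.
by case: eqP => [->|_]; rewrite ?mulr0 ?mul0rn // mulr1.
Qed.

Lemma D_order1 k F : has_order 1 (D k F).
Proof. by apply: has_order1; rewrite DE mnm0E mul0r. Qed.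

Lemma DC j k F : D j (D k F) = D k (D j F).
Proof. by apply/funext => m; rewrite !DE mulrCA. Qed.

(** The geometric series in [1 - F]. If [F] has constant term 1, then [(1 - F) ^+ k] has order at
    least [k], so the cut at [mdeg m] loses nothing. *)
Definition sinv F : series N R := fun m =>
  \sum_(k < (mdeg m).+1) ((1 - F) ^+ k) m.

Lemma sinv_trunc F n :
  F 0%MM = 1 -> has_order n (sinv F - \sum_(k < n) (1 - F) ^+ k).
Proof.
move=> F1 m lt_mn; rewrite seriesBE series_sumE.
have le_mn : ((mdeg m).+1 <= n)%N by [].
have X0 : has_order 1 (1 - F).
  by apply: has_order1; rewrite seriesBE series1E eqxx F1 subrr.
rewrite /sinv (big_ord_widen n (fun k => ((1 - F) ^+ k) m)) //.
rewrite [X in _ - X](bigID (fun k : 'I_n => (k < (mdeg m).+1)%N)) /=.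
rewrite [X in _ - (_ + X)]big1 ?addr0 ?subrr // => k.
rewrite -ltnNge ltnS => lt_mk.
exact: (has_orderX X0).
Qed.

Lemma mulr_sinv F : F 0%MM = 1 -> F * sinv F = 1.
Proof.
move=> F1; apply/eqP; rewrite -subr_eq0; apply/eqP/has_order_eq0 => n.
have X0 : has_order 1 (1 - F).
  by apply: has_order1; rewrite seriesBE series1E eqxx F1 subrr.
have -> : F * sinv F - 1
  = F * (sinv F - \sum_(k < n) (1 - F) ^+ k) - (1 - F) ^+ n.
  have := subrX1 (1 - F) n; rewrite [1 - F - 1]addrAC subrr add0r mulNr => e.
  by rewrite mulrBr -[X in _ = _ - X + _]opprK -e; ring.
by apply: has_orderD; [apply/has_order_mull/sinv_trunc|apply/has_orderN/has_orderX].
Qed.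

Definition mdot a m : nat := (\sum_(i < N) a i * m i)%N.

Lemma mdotDl a b m : mdot (a + b)%MM m = (mdot a m + mdot b m)%N.
Proof.
by rewrite -big_split; apply: eq_bigr => i _; rewrite mnmDE mulnDl.
Qed.

Lemma mdotDr a b m : mdot m (a + b)%MM = (mdot m a + mdot m b)%N.
Proof.
by rewrite -big_split; apply: eq_bigr => i _; rewrite mnmDE mulnDr.
Qed.

Lemma mdot0l m : mdot 0%MM m = 0%N.
Proof. by apply: big1 => i _; rewrite mnm0E. Qed.

Lemma mdot0r m : mdot m 0%MM = 0%N.
Proof. by apply: big1 => i _; rewrite mnm0E muln0. Qed.

Lemma mdot1l i m : mdot U_(i)%MM m = m i.
Proof.
rewrite /mdot (bigD1 i) //= mnm1E eqxx mul1n big1 ?addn0 // => j.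
by rewrite mnm1E eq_sym => /negPf->.
Qed.

Lemma mdot1r i m : mdot m U_(i)%MM = m i.
Proof. by rewrite -[RHS]mdot1l; apply: eq_bigr => j _; rewrite mulnC. Qed.

(* The substitution x_i := t^(a_i) x_i. *)
Definition shift (t : R) a F : series N R := fun m => t ^+ mdot a m * F m.

Lemma shiftM t a F G : shift t a (F * G) = shift t a F * shift t a G.
Proof.
apply/funext => m; rewrite /shift !seriesME mulr_sumr; apply: eq_bigr => k le_km.
by rewrite -{1}(submK le_km) mdotDr exprD; ring.
Qed.

Lemma shift0 t F : shift t 0%MM F = F.
Proof. by apply/funext => m; rewrite /shift mdot0l expr0 mul1r. Qed.

Lemma shift_at0 t a F : shift t a F 0%MM = F 0%MM.
Proof. by rewrite /shift mdot0r expr0 mul1r. Qed.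

Lemma D_shift k t a F : D k (shift t a F) = shift t a (D k F).
Proof. by apply/funext => m; rewrite /shift !DE mulrCA. Qed.

End SeriesTheory.

(** * Logarithmic derivatives over [Qq] *)

Lemma Qq_nat_neq0 n : n.+1%:R != 0 :> Qq.
Proof.
have -> : n.+1%:R = polyQq n.+1%:R by rewrite /polyQq rmorph_nat.
by rewrite polyQq_eq0 -polyC_natr polyC_eq0 pnatr_eq0.
Qed.

Lemma fps_powE N (F : series N Qq) k : fps_pow F k = F ^+ k.
Proof. by elim: k => [|k IH]; rewrite ?expr0 // exprS -IH. Qed.

(** Modulo degree [n], termwise differentiation turns the logarithm into [T * D k F], where [T] is
    the truncated geometric series for the inverse of [F]. *)
Lemma mulr_D_log N (F : series N Qq) k :
  F 0%MM = 1 -> F * D k (fps_log F) = D k F.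
Proof.
move=> F1; apply/eqP; rewrite -subr_eq0; apply/eqP/has_order_eq0 => n.
pose X := 1 - F.
have X0 : has_order 1 X.
  by apply: has_order1; rewrite /X seriesBE series1E eqxx F1 subrr.
pose T := \sum_(j < n) X ^+ j.
have XT : F * T = 1 - X ^+ n.
  have := subrX1 X n; rewrite [X - 1]addrAC subrr add0r mulNr => e.
  by apply: (canRL (addrK _)); rewrite -[X in X + _]opprK -e; ring.
suff ord : has_order n (D k (fps_log F) - T * D k F).
  have -> : F * D k (fps_log F) - D k F
    = F * (D k (fps_log F) - T * D k F) - X ^+ n * D k F.
    by rewrite mulrBr mulrA XT; ring.
  apply: has_orderD; first exact: has_order_mull.
  by apply: has_orderN; rewrite mulrC; apply/has_order_mull/has_orderX.
move=> m lt_mn; rewrite seriesBE DE /fps_log big_add1 /= mulr_sumr.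
rewrite mulr_suml series_sumE.
rewrite [X in _ - X](eq_bigr (fun j : 'I_n => (X ^+ j * D k F) m)) //.
(* Since [D k F] has order 1, the powers with [j >= mdeg m] do not reach the coefficient at [m];
   this matches the cut in [fps_log]. *)
have -> : \sum_(j < n) (X ^+ j * D k F) m
          = \sum_(j < mdeg m) (X ^+ j * D k F) m.
  rewrite [RHS](big_ord_widen n (fun j => (X ^+ j * D k F) m)) 1?ltnW //.
  rewrite [LHS](bigID (fun j : 'I_n => (j < mdeg m)%N)) /=.
  rewrite [X in _ + X]big1 ?addr0 // => j; rewrite -leqNgt => le_mj.
  suff /has_orderM/(_ (D_order1 k F)) : has_order j (X ^+ j).
    by apply; rewrite addn1 ltnS.
  exact: has_orderX.
rewrite big_mkord; apply/eqP; rewrite subr_eq0; apply/eqP.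
apply: eq_bigr => j _; rewrite fps_powE /= /fps_sub.
have -> : (fun m0 => F m0 - fps_one m0) = - X :> series N Qq.
  by apply/funext => u; rewrite seriesNE /X seriesBE opprB.
have sgnE (Y : series N Qq) u : ((-1) ^+ j * Y) u = (-1) ^+ j * Y u.
  rewrite -[in LHS]signr_odd -[in RHS]signr_odd.
  by case: odd; rewrite /= ?expr0 ?expr1 ?mul1r ?mulN1r.
have DXF : D k (- X) = D k F.
  by rewrite /X opprB raddfB /= D1 subr0.
have : D k ((- X) ^+ j.+1) m = (-1) ^+ j * (X ^+ j * D k F) m *+ j.+1.
  by rewrite DX DXF [(- X) ^+ j]exprNn -mulrA seriesMnE sgnE.
have -> : fps_mul (- X) ((- X) ^+ j) m = ((- X) ^+ j.+1) m by rewrite exprS.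
rewrite DE => e.
(* The factor [j.+1] from the derivative of the power cancels the denominator in the logarithm, and
   the two signs cancel each other. *)
rewrite mulrCA e -[X in _ * X]mulr_natr; move: ((X ^+ j * D k F) m) => Y.
transitivity (((-1) ^+ j * (-1) ^+ j) * (j.+1%:R / j.+1%:R) * Y); first by ring.
by rewrite -expr2 sqrr_sign divff ?mul1r // Qq_nat_neq0.
Qed.

(** * Values at q = 1 *)

Lemma has_valueC a (p : {poly rat}) : has_value (polyQq p) a p.[a].
Proof.
by exists p, 1; rewrite hornerC oner_eq0 /polyQq rmorph1 !divr1; split.
Qed.

Lemma has_value_nat a n : has_value n%:R a n%:R.
Proof.
have := has_valueC a n%:R.
by rewrite {1}/polyQq rmorph_nat -polyC_natr hornerC.
Qed.

Lemma has_valueD f g a v w :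
  has_value f a v -> has_value g a w -> has_value (f + g) a (v + w).
Proof.
move=> [n [d [d0 -> ->]]] [n' [d' [d'0 -> ->]]].
have nz (p : {poly rat}) : p.[a] != 0 -> polyQq p != 0.
  by rewrite polyQq_eq0; apply: contraNneq => ->; rewrite horner0.
exists (n * d' + n' * d), (d * d'); rewrite hornerD !hornerM mulf_neq0 //.
split=> //; last by rewrite addf_div.
by rewrite addf_div ?nz // /polyQq rmorphD !rmorphM.
Qed.

Lemma has_valueM f g a v w :
  has_value f a v -> has_value g a w -> has_value (f * g) a (v * w).
Proof.
move=> [n [d [d0 -> ->]]] [n' [d' [d'0 -> ->]]].
exists (n * n'), (d * d'); rewrite !hornerM mulf_neq0 //; split=> //.
  by rewrite mulf_div /polyQq !rmorphM.
by rewrite mulf_div.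
Qed.

Lemma has_valueN f a v : has_value f a v -> has_value (- f) a (- v).
Proof.
move=> [n [d [d0 -> ->]]]; exists (- n), d; split=> //.
  by rewrite /polyQq rmorphN mulNr.
by rewrite hornerN mulNr.
Qed.

Lemma has_valueB f g a v w :
  has_value f a v -> has_value g a w -> has_value (f - g) a (v - w).
Proof. by move=> fv /has_valueN; apply: has_valueD. Qed.

Lemma has_value_int (x : rat) (z : int) : has_value z%:~R x z%:~R.
Proof.
case: z => n; first exact: has_value_nat.
by rewrite !NegzE !mulrNz; apply: has_valueN; apply: has_value_nat.
Qed.

Lemma has_valueV f a v : v != 0 -> has_value f a v -> has_value f^-1 a v^-1.
Proof.
move=> v0 [n [d [d0 -> e]]]; exists d, n; rewrite !invf_div e invf_div.
by split=> //; apply: contraNneq v0 => n0; rewrite e n0 mul0r.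
Qed.

Lemma has_valueX f a v n : has_value f a v -> has_value (f ^+ n) a (v ^+ n).
Proof.
move=> fv; elim: n => [|n IH]; first by rewrite !expr0; apply: (has_value_nat _ 1).
by rewrite !exprS; apply: has_valueM.
Qed.

Lemma has_value_sum (I : Type) (r : seq I) (P : pred I) (f : I -> Qq) v a :
    (forall i, P i -> has_value (f i) a (v i)) ->
  has_value (\sum_(i <- r | P i) f i) a (\sum_(i <- r | P i) v i).
Proof.
move=> fv; apply: (big_ind2 (fun f v => has_value f a v)) => //.
  exact: (has_value_nat _ 0).
by move=> *; apply: has_valueD.
Qed.

Lemma has_value_qX : has_value qX 1 1.
Proof. by have := has_valueC 1 'X; rewrite hornerX. Qed.

Lemma has_value_qXn n : has_value (qX ^+ n) 1 1.
Proof. by have := has_valueX n has_value_qX; rewrite expr1n. Qed.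

(** The substitution [q := q^k] fixes the point 1. *)
Lemma has_value_subst k f v :
  (0 < k)%N -> has_value f 1 v -> has_value (subst_q k f) 1 v.
Proof.
move=> k0 [n [d [d0 -> ->]]]; exists (n \Po 'X^k), (d \Po 'X^k).
rewrite !horner_comp !hornerXn !expr1n; split=> //.
by rewrite subst_qE //; apply: contraNneq d0 => ->; rewrite horner0.
Qed.

Lemma subst_q_mul_polyQq k p f : (0 < k)%N ->
  subst_q k (polyQq p * f) = polyQq (p \Po 'X^k) * subst_q k f.
Proof.
move=> k0; rewrite {1}[f]Qq_numden mulrA -polyQqM subst_qE ?denom_ratioP //.
by rewrite comp_polyM polyQqM -mulrA.
Qed.

Lemma polyQq_X1 k : polyQq (('X - 1) \Po 'X^k) = qX ^+ k - 1.
Proof.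
by rewrite comp_polyB comp_polyX comp_polyC /polyQq rmorphB rmorphXn rmorph1.
Qed.

Lemma qX_neq1 k : (0 < k)%N -> qX ^+ k - 1 != 0.
Proof.
move=> k0; rewrite -polyQq_X1 polyQq_eq0 comp_Xn_eq0 //.
by rewrite -polyC1 polyXsubC_eq0.
Qed.

(** The q-integer of [k]: the quotient of [q^k - 1] by [q - 1], through which poles at 1 are
    controlled. *)
Definition q_int k : Qq := \sum_(i < k) qX ^+ i.

Lemma q_intE k : qX ^+ k - 1 = (qX - 1) * q_int k.
Proof. exact: subrX1. Qed.

Lemma has_value_q_int k : has_value (q_int k) 1 k%:R.
Proof.
have -> : k%:R = \sum_(i < k) 1 :> rat by rewrite sumr_const card_ord.
apply: has_value_sum => i _; have := has_valueX i has_value_qX.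
by rewrite expr1n.
Qed.

Lemma q_int_neq0 k : (0 < k)%N -> q_int k != 0.
Proof. by move=> /qX_neq1; rewrite q_intE mulf_eq0 negb_or => /andP[]. Qed.

Section SeriesValue.
Variable N : nat.
Implicit Types (F G : series N Qq) (f g : series N rat).

Definition series_value F f := forall m, has_value (F m) 1 (f m).

Lemma series_value1 : series_value 1 1.
Proof. by move=> m; rewrite !series1E; apply: has_value_nat. Qed.

Lemma series_valueD F G f g :
  series_value F f -> series_value G g -> series_value (F + G) (f + g).
Proof. by move=> Ff Gg m; apply: has_valueD. Qed.

Lemma series_valueB F G f g :
  series_value F f -> series_value G g -> series_value (F - G) (f - g).
Proof. by move=> Ff Gg m; apply: has_valueB. Qed.

Lemma series_valueM F G f g :
  series_value F f -> series_value G g -> series_value (F * G) (f * g).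
Proof. by move=> Ff Gg m; apply: has_value_sum => k _; apply: has_valueM. Qed.

Lemma series_valueX F f n : series_value F f -> series_value (F ^+ n) (f ^+ n).
Proof.
move=> Ff; elim: n => [|n IH]; first exact: series_value1.
by rewrite !exprS; apply: series_valueM.
Qed.

Lemma series_value_inv F f : series_value F f -> series_value (sinv F) (sinv f).
Proof.
move=> Ff m; apply: has_value_sum => k _.
by apply: series_valueX; apply: series_valueB Ff; apply: series_value1.
Qed.

Lemma series_value_D k F f : series_value F f -> series_value (D k F) (D k f).
Proof. by move=> Ff m; apply: has_valueM => //; apply: has_value_nat. Qed.

Lemma series_value_uniq F f g : series_value F f -> series_value F g -> f = g.
Proof. by move=> Ff Fg; apply/funext => m; apply: has_value_uniq (Ff m) (Fg m). Qed.

Lemma series_value_exists F :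
  (forall m, exists v, has_value (F m) 1 v) -> exists f, series_value F f.
Proof. by case/boolp.choice => f Ff; exists f. Qed.

End SeriesValue.

(** * The q-difference equations of the Hua series *)

Section ShiftRecursion.
Variable N : nat.
Implicit Types (a b m n : 'X_{1..N}) (i j k : 'I_N).

Lemma mnm_neq0P m : m != 0%MM -> exists i, m i != 0%N.
Proof.
move=> m0; apply/existsP; apply: contraR m0 => /existsPn mi.
by apply/eqP/mnmP => i; apply/eqP; rewrite mnm0E -[_ == _]negbK; apply: mi.
Qed.

(* The recursion determines a family at degree d from smaller degrees, up to
   its differences in a; hence it is determined by its value at a = 0. *)
Lemma shift_ind (h : 'I_N -> 'X_{1..N}) (P : 'X_{1..N} -> 'X_{1..N} -> Prop) :
    (forall m, P 0%MM m) ->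
    (forall b i m, P b m ->
       ((U_(i) <= m)%MM -> P (b + U_(i) + h i)%MM (m - U_(i))%MM) ->
       P (b + U_(i))%MM m) ->
  forall a m, P a m.
Proof.
move=> P0 PS a m; have [d] := ubnP (mdeg m); elim: d => // d IHd in a m *.
move=> lt_md; have [e] := ubnP (mdeg a); elim: e => // e IHe in a *.
move=> lt_ae; have [->//|/mnm_neq0P[i ai]] := eqVneq a 0%MM.
have le_ia : (U_(i) <= a)%MM by rewrite lep1mP.
rewrite -(submK le_ia) in lt_ae *; apply: PS => [|le_im].
  by apply: IHe; move: lt_ae; rewrite mdegD mdeg1 addn1.
by apply: IHd; move: lt_md; rewrite -{1}(submK le_im) mdegD mdeg1 addn1.
Qed.

Definition shift_rec (R : comNzRingType) (h : 'I_N -> 'X_{1..N})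
    (X : 'X_{1..N} -> series N R) :=
  forall b i, X (b + U_(i))%MM =
    X b + monom R U_(i) * X (b + U_(i) + h i)%MM.

(** The recursion is linear and stable under translation of the index; with the next two lemmas,
    uniqueness yields [r_add] and [binom_series_r]. *)
Lemma shift_rec_uniq (R : comNzRingType) h (X Y : 'X_{1..N} -> series N R) :
  shift_rec h X -> shift_rec h Y -> X 0%MM = Y 0%MM -> forall a, X a = Y a.
Proof.
move=> Xr Yr XY0 a; apply/funext => m; move: a m.
apply: (@shift_ind h) => [m|b i m eb ei]; first by rewrite XY0.
rewrite Xr Yr !seriesDE !coef_monomM eb; case: ifP => [/ei->|] //.
Qed.

Lemma shift_rec_mulr (R : comNzRingType) h (X : 'X_{1..N} -> series N R) F :
  shift_rec h X -> shift_rec h (fun a => X a * F).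
Proof. by move=> Xr b i; rewrite Xr; ring. Qed.

Lemma shift_rec_translate (R : comNzRingType) h (X : 'X_{1..N} -> series N R) c :
  shift_rec h X -> shift_rec h (fun a => X (a + c)%MM).
Proof.
have AC (x y z : 'X_{1..N}) : (x + y + z = x + z + y)%MM.
  by rewrite -!addmA [(y + z)%MM]addmC.
by move=> Xr b i; rewrite [(_ + h i + c)%MM]AC [(b + U_(i) + c)%MM]AC; apply: Xr.
Qed.

Lemma P_D (i : nat) m n : P_ i (m + n)%MM = (P_ i m + P_ i n)%N.
Proof.
by rewrite -big_split; apply: eq_bigr => j _; rewrite mnmDE mulnDr.
Qed.

Lemma P_1 (i : nat) k : P_ i U_(k)%MM = minn i k.+1.
Proof.
rewrite /P_ (bigD1 k) //= mnm1E eqxx muln1 big1 ?addn0 // => j.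
by rewrite mnm1E eq_sym => /negPf->; rewrite muln0.
Qed.

Lemma P_gt0 (n : nat) m : (0 < n)%N -> m != 0%MM -> (0 < P_ n m)%N.
Proof.
move=> n0 /mnm_neq0P[i]; rewrite -lt0n => mi; rewrite /P_ (bigD1 i) //= addn_gt0.
by rewrite muln_gt0 leq_min n0 mi.
Qed.

Lemma quad_formE m : quad_form m = (\sum_i m i * P_ i.+1 m)%N.
Proof.
apply: eq_bigr => i _; rewrite /P_ big_distrr.
by apply: eq_bigr => j _; rewrite /= mulnA.
Qed.

Lemma quad_formD1 n i :
  quad_form (n + U_(i))%MM = (quad_form n + 2 * P_ i.+1 n + i.+1)%N.
Proof.
have U (E : 'I_N -> nat) : (\sum_j U_(i)%MM j * E j = E i)%N.
  rewrite (bigD1 i) //= mnm1E eqxx mul1n big1 ?addn0 // => j.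
  by rewrite mnm1E eq_sym => /negPf->.
rewrite !quad_formE.
under eq_bigr do rewrite P_D mnmDE mulnDl !mulnDr.
rewrite !big_split /= !U P_1 minnn.
have -> : (\sum_j n j * P_ j.+1 U_(i)%MM = P_ i.+1 n)%N.
  by apply: eq_bigr => j _; rewrite P_1 minnC mulnC.
by ring.
Qed.

(* The exponents of the shift attached to x_i by the quadratic form
   [2 (g - 1) min(i, j)]. *)
Definition hshift (rho : nat) i : 'X_{1..N} :=
  [multinom (rho * minn i.+1 j.+1)%N | j < N].

Lemma mdot_hshift rho i m : mdot (hshift rho i) m = (rho * P_ i.+1 m)%N.
Proof.
rewrite /mdot /P_ big_distrr; apply: eq_bigr => j _.
by rewrite mnmE /= mulnA.
Qed.

Definition series_scale (R : comNzRingType) (c : R) (F : series N R) : series N R :=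
  fun m => c * F m.

Lemma series_scaleMl (R : comNzRingType) (c : R) (F G : series N R) :
  series_scale c (F * G) = series_scale c F * G.
Proof.
apply/funext => m; rewrite /series_scale !seriesME mulr_sumr.
by apply: eq_bigr => k _; rewrite mulrA.
Qed.

Lemma qX_neq0 : qX != 0.
Proof. by rewrite polyQq_eq0 polyX_eq0. Qed.

(** Passing from [n] to [n + U_(i)] adds one factor [1 - q^-(n_i + 1)] to the denominator, and
    [quad_formD1] gives the change of the exponent. *)
Lemma HuaD1 g n i :
  (qX ^+ (n i).+1 - 1) * Hua g (n + U_(i))%MM
  = qX ^+ ((n i).+1 + (g - 1) * (2 * P_ i.+1 n + i.+1)) * Hua g n.
Proof.
rewrite /Hua quad_formD1 [in LHS](bigD1 i) // [in RHS](bigD1 i) //=.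
have -> : \prod_(j < N | j != i) qpoch qX^-1 ((n + U_(i))%MM j)
        = \prod_(j < N | j != i) qpoch qX^-1 (n j).
  apply: eq_bigr => j /negPf ji.
  by rewrite mnmDE mnm1E eq_sym ji addn0.
rewrite mnmDE mnm1E eqxx addn1 {1}/qpoch big_nat_recr //= -/(qpoch qX^-1 (n i)).
set A := qpoch _ _; set B := \prod_(_ < _ | _) _; set k := (n i).+1.
have e : qX ^+ k - 1 = qX ^+ k * (1 - qX^-1 ^+ k).
  by rewrite exprVn mulrBr mulr1 mulfV // expf_neq0 ?qX_neq0.
have nz : 1 - qX^-1 ^+ k != 0.
  have := qX_neq1 (isT : (0 < k)%N); rewrite e mulf_eq0 negb_or.
  by case/andP.
rewrite e !invfM -addnA mulnDr exprD [in RHS]exprD.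
set T := 1 - _ in nz *.
transitivity (qX ^+ k * (T / T) * (qX ^+ ((g - 1) * quad_form n) *
  qX ^+ ((g - 1) * (2 * P_ i.+1 n + i.+1)) * (A^-1 / B))); first by ring.
by rewrite divff //; ring.
Qed.

(** At [m] the first two shifts differ by a factor [q^(m_i) - 1], which [HuaD1] trades for the
    coefficient at [m - U_(i)]. The resulting exponent is affine in [m - U_(i)]: its linear part is
    the last shift, its constant part the scalar. *)
Lemma Hua_shift_rec g b i :
  shift qX (b + U_(i))%MM (@Hua g N) = shift qX b (@Hua g N) +
    series_scale (qX ^+ (b i + 1 + (g - 1) * i.+1))
      (monom Qq U_(i) * shift qX (b + U_(i) + hshift (2 * (g - 1)) i)%MM (@Hua g N)).
Proof.
apply/funext => m; rewrite seriesDE /series_scale coef_monomM.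
rewrite {1 2}/shift; case: ifPn; last first.
  rewrite lep1mP negbK => /eqP mi.
  by rewrite mdotDl mdot1l mi addn0 mulr0 addr0.
move=> le_im; rewrite -{1 2 3 4}(submK le_im); set n := (m - U_(i))%MM.
apply/eqP; rewrite addrC -subr_eq; apply/eqP.
rewrite mdotDl exprD mdot1l mnmDE mnm1E eqxx !addn1.
transitivity (qX ^+ mdot b (n + U_(i))%MM *
  ((qX ^+ (n i).+1 - 1) * Hua g (n + U_(i))%MM)); first by ring.
rewrite HuaD1 /shift !mulrA -!exprD; congr (_ ^+ _ * _).
rewrite !mdotDl mdotDr mdot1r mdot1l mdot_hshift.
by ring.
Qed.

End ShiftRecursion.

(** * Products of binomial coefficients *)

Section Binomials.
Variable R : comUnitRingType.
Implicit Types (y : R) (n : nat).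

Definition rise y n : R := \prod_(j < n) (y + j%:R).

Lemma riseSr y n : rise y n.+1 = rise y n * (y + n%:R).
Proof. exact: big_ord_recr. Qed.

Lemma riseSl y n : rise y n.+1 = y * rise (y + 1) n.
Proof.
rewrite /rise big_ord_recl addr0; congr (_ * _).
by apply: eq_bigr => j _; rewrite /= /bump leq0n natrD addrA.
Qed.

Lemma gbinom_rise y n : gbinom (y - 1 + n%:R) n = rise y n / (n`!)%:R.
Proof.
congr (_ / _); rewrite (reindex_inj rev_ord_inj); apply: eq_bigr => j _ /=.
by rewrite natrB // -natr1; ring.
Qed.

(** Compares the rising factorial of length [n.+1] with its first and with its last factor split
    off. *)
Lemma gbinom_mul y n :
  n%:R * gbinom (y - 1 + n%:R) n
  = y * (gbinom (y + 1 - 1 + n%:R) n - gbinom (y - 1 + n%:R) n).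
Proof.
rewrite !gbinom_rise -mulrBl !mulrA; congr (_ / _).
by rewrite mulrBr -riseSl riseSr; ring.
Qed.

(** The coefficients of the series G_a, over a general ring because they are needed both at a number
    rho and at the indeterminate. *)
Definition binom_prod_shift N y (a m : 'X_{1..N}) : R :=
  \prod_(i < N) gbinom (y * (P_ i.+1 m)%:R + (a i)%:R - 1 + (m i)%:R) (m i).

Lemma binom_prod_shift0 N y (m : 'X_{1..N}) :
  binom_prod_shift y 0%MM m = binom_prod y m.
Proof. by apply: eq_bigr => i _; rewrite mnm0E addr0. Qed.

Lemma binom_prod_shift_mul N y (m : 'X_{1..N}) i :
  (m i)%:R * binom_prod_shift y 0%MM m = y * (P_ i.+1 m)%:R *
    (binom_prod_shift y U_(i)%MM m - binom_prod_shift y 0%MM m).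
Proof.
rewrite /binom_prod_shift (bigD1 i) //= [X in _ * (X - _)](bigD1 i) //=.
rewrite mnm0E addr0 mnm1E eqxx mulrA gbinom_mul -mulrA mulrBl; congr (_ * (_ - _)).
congr (_ * _); apply: eq_bigr => j ji.
by rewrite mnm0E mnm1E eq_sym (negPf ji).
Qed.

End Binomials.

(** Pascal's rule. *)
Lemma gbinomS (y : rat) n :
  gbinom (y + 1 - 1 + n.+1%:R) n.+1 - gbinom (y - 1 + n.+1%:R) n.+1
  = gbinom (y + 1 - 1 + n%:R) n.
Proof.
rewrite !gbinom_rise -mulrBl riseSr riseSl [y * _]mulrC -mulrBr -mulrA.
congr (_ * _); have -> : y + 1 + n%:R - y = n.+1%:R by rewrite -natr1; ring.
by rewrite factS natrM invfM mulrA divff ?mul1r // pnatr_eq0.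
Qed.

Lemma horner_gbinom (p : {poly rat}) x k : (gbinom p k).[x] = gbinom p.[x] k.
Proof.
rewrite /gbinom -polyC_natr polyCV hornerM hornerC horner_prod; congr (_ * _).
by apply: eq_bigr => j _; rewrite -polyC_natr hornerD hornerN hornerC.
Qed.

Lemma horner_binom_prod_shift N (a m : 'X_{1..N}) x :
  (binom_prod_shift ('X : {poly rat}) a m).[x] = binom_prod_shift x a m.
Proof.
rewrite /binom_prod_shift horner_prod; apply: eq_bigr => i _.
rewrite horner_gbinom -!polyC_natr; congr gbinom.
by rewrite -polyC1 !(hornerD, hornerN, hornerM, hornerC, hornerX).
Qed.

Section BinomialSeries.
Variables (N rho : nat).
Implicit Types (a b m : 'X_{1..N}) (i : 'I_N).

Definition binom_series a : series N rat := binom_prod_shift rho%:R a.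

(** The series Q with G_0 = 1 + rho Q; dividing before evaluating gives it a meaning at rho = 0. *)
Definition binom_series_quot : series N rat := fun m =>
  if m == 0%MM then 0 else (binom_prod 'X m %/ 'X).[rho%:R].

Lemma binom_seriesE a m :
  binom_series a m =
  \prod_(i < N) gbinom ((rho * P_ i.+1 m + a i)%:R - 1 + (m i)%:R) (m i).
Proof. by apply: eq_bigr => i _; rewrite natrD natrM. Qed.

(** Raising [b i] by one affects factor [i] only, where Pascal's rule lowers [m i] by one. In every
    factor, the drop of [P_] from [m] to [m - U_(i)] is compensated by [hshift rho i]. *)
Lemma binom_series_rec : shift_rec (hshift rho) binom_series.
Proof.
move=> b i; apply/funext => m; rewrite seriesDE coef_monomM.
case: ifPn => [le_im|]; last first.
  rewrite lep1mP negbK => /eqP mi; rewrite addr0 !binom_seriesE.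
  apply: eq_bigr => j _; have [<-|ij] := eqVneq i j; last first.
    by rewrite mnmDE mnm1E (negPf ij) addn0.
  by rewrite mi /gbinom !big_ord0.
rewrite -{1 2}(submK le_im); set n := (m - U_(i))%MM.
apply/eqP; rewrite addrC -subr_eq; apply/eqP; rewrite !binom_seriesE.
rewrite (bigD1 i) //= [X in _ - X](bigD1 i) //= [RHS](bigD1 i) //=.
set T := \prod_(_ < _ | _) _; set T1 := \prod_(_ < _ | _) _.
have -> : T1 = T.
  apply: eq_bigr => j ji; rewrite /= !mnmDE mnm1E eq_sym (negPf ji).
  by rewrite !addn0.
set T2 := \prod_(_ < _ | _) _.
have -> : T2 = T.
  apply: eq_bigr => j ji; rewrite /= !mnmDE mnm1E [i == j]eq_sym (negPf ji) !addn0.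
  rewrite P_D P_1 mnmE minnC mulnDr.
  by rewrite -addnA [(b j + _)%N]addnC addnA.
rewrite -mulrBl; congr (_ * _).
have hii : hshift rho i i = (rho * i.+1)%N by rewrite mnmE minnn.
rewrite !mnmDE mnm1E eqxx P_D P_1 hii minnn !addn1 addnS -natr1 gbinomS.
by congr (gbinom (_ - 1 + _) _); rewrite natr1; congr _%:R; ring.
Qed.

Lemma binom_series0 : binom_series 0%MM = 1 + binom_series_quot *+ rho.
Proof.
apply/funext => m; rewrite seriesDE seriesMnE series1E /binom_series_quot.
rewrite /binom_series binom_prod_shift0; case: eqP => [->|/eqP m0].
  rewrite mul0rn addr0 /binom_prod big1 // => i _.
  by rewrite mnm0E /gbinom big_ord0 fact0 divr1.
rewrite add0r -horner_binom_prod -{1}(divpK (dvdX_binom_prod m0)).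
by rewrite hornerM hornerX mulr_natr.
Qed.

(** This is [binom_prod_shift_mul] divided by rho: [P_ i.+1 m] is the eigenvalue at x^m of the
    operator sum_j min(i+1, j+1) D_j. *)
Lemma D_binom_series_quot i :
  D i binom_series_quot =
  \sum_(j < N) D j (binom_series U_(i)%MM - binom_series 0%MM) *+ minn i.+1 j.+1.
Proof.
apply/funext => m; rewrite series_sumE DE /binom_series_quot.
transitivity ((P_ i.+1 m)%:R * (binom_series U_(i)%MM - binom_series 0%MM) m);
  last first.
  rewrite /P_ natr_sum mulr_suml; apply: eq_bigr => j _.
  by rewrite seriesMnE DE natrM -mulrA mulr_natl.
case: eqP => [->|/eqP m0].
  by rewrite mulr0 /P_ big1 ?mul0r // => j _; rewrite mnm0E muln0.
have := binom_prod_shift_mul ('X : {poly rat}) m i.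
rewrite {1}binom_prod_shift0 -{1}(divpK (dvdX_binom_prod m0)) mulrA [RHS]mulrAC.
(* The indeterminate is cancelled before evaluation, so rho = 0 is allowed. *)
rewrite -[RHS]mulrA [RHS]mulrC => /(mulIf (negbT (polyX_eq0 _))).
move/(congr1 (horner^~ rho%:R)).
rewrite -!polyC_natr !(hornerM, hornerD, hornerN, hornerC).
by rewrite !horner_binom_prod_shift => ->; rewrite mulrC.
Qed.

End BinomialSeries.

(** * The differential system at q = 1 *)

Section DifferentialSystem.
Variables (N rho : nat) (r : 'X_{1..N} -> series N rat) (B : series N rat).
Hypothesis r_rec : shift_rec (hshift rho) r.
Hypothesis r0 : r 0%MM = 1.
Hypothesis r_D : forall a k, D k (r a) = r a * \sum_j D k (D j B) *+ a j.
Implicit Types (i j k : 'I_N) (n : nat) (F G X : series N rat).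

Definition theta F : series N rat := \sum_k D k F.

Lemma theta_is_additive : {morph theta : F G / F - G}.
Proof.
move=> F G; rewrite /theta -sumrB; apply: eq_bigr => k _; exact: raddfB.
Qed.

HB.instance Definition _ :=
  GRing.isZmodMorphism.Build (series N rat) (series N rat) theta theta_is_additive.

Lemma thetaM F G : theta (F * G) = theta F * G + F * theta G.
Proof.
rewrite /theta mulr_suml mulr_sumr -big_split; apply: eq_bigr => k _; exact: DM.
Qed.

Lemma theta1 : theta 1 = 0.
Proof. by rewrite /theta big1 // => k _; apply: D1. Qed.

Lemma thetaE F m : theta F m = (mdeg m)%:R * F m.
Proof. by rewrite /theta series_sumE mdegE natr_sum mulr_suml. Qed.

(** If [F] has order [n], then [X * F] has order [n.+1], while [theta] multiplies degree [n] by [n];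
    so the order of [F] increases indefinitely. *)
Lemma theta_eq0 F X : F 0%MM = 0 -> X 0%MM = 0 -> theta F = X * F -> F = 0.
Proof.
move=> F0 X0 e; apply: has_order_eq0 => n; elim: n => [//|n IH] m.
rewrite ltnS => le_mn.
have [->//|m0] := eqVneq m 0%MM.
have : theta F m = 0 by rewrite e (has_orderM (has_order1 X0) IH) // add1n ltnS.
by move/eqP; rewrite thetaE mulf_eq0 pnatr_eq0 mdeg_eq0 (negPf m0) => /eqP.
Qed.

Lemma r_add a c : r (a + c)%MM = r a * r c.
Proof.
move: a; apply: shift_rec_uniq (shift_rec_translate c r_rec) (shift_rec_mulr _ r_rec) _.
by rewrite r0 mul1r add0m.
Qed.

(** [b] is the Hessian of [B] for the derivations [D], and [kk n k] is D_k of sum_j min(n, j+1) D_j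
    B. The logarithmic derivative of [z i] is the Kronecker delta plus rho times [kk i.+1]; [U] and
    [V] arise by summing it over [k] with weights 1 and [k.+1]. *)
Let b j k := D k (D j B).
Let t i := r U_(i)%MM - 1.
Let z i := monom rat U_(i) * r (hshift rho i).
Let kk n k := \sum_j b j k *+ minn n j.+1.
Let U n := 1 + (\sum_k kk n k) *+ rho.
Let V i := i.+1%:R + (\sum_k kk i.+1 k *+ k.+1) *+ rho.

Lemma bC j k : b j k = b k j. Proof. exact: DC. Qed.

Lemma rU i : r U_(i)%MM = 1 + t i.
Proof. by rewrite /t addrC subrK. Qed.

Lemma t_z i : t i = z i * (1 + t i).
Proof.
have := r_rec 0%MM i; rewrite !add0m r0 addmC r_add mulrA -/(z i) rU.
exact: addrI.
Qed.

Lemma D_t k i : D k (t i) = (1 + t i) * b i k.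
Proof.
rewrite {1}/t raddfB /= D1 subr0 r_D rU (bigD1 i) //= mnm1E eqxx mulr1n big1 ?addr0 //.
by move=> j; rewrite mnm1E eq_sym => /negPf->.
Qed.

Lemma D_z k i : D k (z i) = z i * ((i == k)%:R + kk i.+1 k *+ rho).
Proof.
rewrite /z DM D_monom mnm1E r_D mulrDr -!mulrA; congr (_ + _).
  by rewrite mulrnAl -mulrnAr -mulr_natr.
rewrite -sumrMnl; do 2 congr (_ * _); apply: eq_bigr => j _.
by rewrite mnmE mulnC mulrnA.
Qed.

(** Differentiate [t i = z i * (1 + t i)] and solve for [b i k], using that [1 + t i] is the inverse
    of [1 - z i]. *)
Lemma b_t i k : b i k = t i * ((i == k)%:R + kk i.+1 k *+ rho).
Proof.
set E := (X in t i * X).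
have e1 : (1 + t i) * (1 - z i) = 1.
  by rewrite mulrBr [_ * z i]mulrC mulr1 -t_z addrK.
have e2 : (1 + t i) * b i k = z i * E * (1 + t i) + z i * ((1 + t i) * b i k).
  by rewrite -D_t {1}t_z DM D_z raddfD /= D1 add0r.
transitivity ((1 + t i) * (1 - z i) * b i k); first by rewrite e1 mul1r.
transitivity ((1 + t i) * b i k - z i * ((1 + t i) * b i k)); first by ring.
by rewrite {1}e2 addrK [in RHS]t_z; ring.
Qed.

Lemma sum_delta i (f : 'I_N -> series N rat) : \sum_k (i == k)%:R * f k = f i.
Proof.
rewrite (bigD1 i) //= eqxx mul1r big1 ?addr0 // => k.
by rewrite eq_sym => /negPf->; rewrite mul0r.
Qed.

Lemma sum_b i : \sum_k b i k = t i * U i.+1.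
Proof.
rewrite /U -sumrMnl mulrDr mulr1 -[X in X + _](@sum_delta i (fun=> t i)).
rewrite mulr_sumr -big_split.
by apply: eq_bigr => k _; rewrite b_t /=; ring.
Qed.

Lemma sum_bw i : \sum_k b i k *+ k.+1 = t i * V i.
Proof.
rewrite /V -sumrMnl mulrDr -[_ * i.+1%:R](@sum_delta i (fun k => t i * k.+1%:R)).
rewrite mulr_sumr -big_split; apply: eq_bigr => k _; rewrite b_t /=.
by ring.
Qed.

(** A closed linear system whose kernel min is symmetric; [VE] is the same system with constant term
    [i.+1] instead of 1. Symmetry lets the two be paired in [theta_W]. *)
Lemma UE n : U n = 1 + (\sum_j (t j * U j.+1) *+ minn n j.+1) *+ rho.
Proof.
rewrite /U /kk exchange_big; congr (_ + _ *+ _); apply: eq_bigr => j _.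
by rewrite sumrMnl sum_b.
Qed.

Lemma VE i : V i = i.+1%:R + (\sum_j (t j * V j) *+ minn i.+1 j.+1) *+ rho.
Proof.
rewrite /V /kk; congr (_ + _ *+ _).
under eq_bigr do rewrite -sumrMnl.
rewrite exchange_big; apply: eq_bigr => j _; rewrite -sum_bw -sumrMnl.
by apply: eq_bigr => k _; rewrite mulrnAC.
Qed.

(** By [sum_b], this is [theta] of sum_j (j+1) D_j B. *)
Let W := \sum_j (t j * U j.+1) *+ j.+1.
Let K := \sum_j (1 + t j) * U j.+1 * kk j.+1 j.

Lemma U_N : U N = 1 + W *+ rho.
Proof.
by rewrite UE; congr (_ + _ *+ _); apply: eq_bigr => j _; rewrite (minn_idPr _).
Qed.

Lemma kk_N k : kk N k = t k * V k.
Proof.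
rewrite -sum_bw; apply: eq_bigr => j _.
by rewrite bC (minn_idPr _).
Qed.

Lemma minn_subK n j : (minn n j.+1 + (j.+1 - n) = minn N j.+1)%N.
Proof. by rewrite [minn N _](minn_idPr _) // minnE; lia. Qed.

(* As functions of n, both [kk n k] for n > k and [U n] solve the same second
   order linear recursion, with the same condition at the right end n = N;
   hence they are proportional. *)
Lemma kk_U n k : (k < n)%N -> (n <= N)%N -> kk n k * U N = kk N k * U n.
Proof.
have [d] := ubnP (N - n); elim: d n => // d IH n lt_d lt_kn le_nN.
(* Only the indices with [n < j.+1] contribute to the differences between [N] and [n]. *)
have e1 : kk N k = kk n k + \sum_j b j k *+ (j.+1 - n).
  by rewrite -big_split; apply: eq_bigr => j _; rewrite /= -mulrnDr minn_subK.
have e2 : U N = U n + (\sum_j (t j * U j.+1) *+ (j.+1 - n)) *+ rho.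
  rewrite !UE -addrA -mulrnDl -big_split; congr (_ + _ *+ _).
  by apply: eq_bigr => j _; rewrite /= -mulrnDr minn_subK.
have e3 : (\sum_j b j k *+ (j.+1 - n)) * U N
        = kk N k * ((\sum_j (t j * U j.+1) *+ (j.+1 - n)) *+ rho).
  rewrite -sumrMnl mulr_suml mulr_sumr; apply: eq_bigr => j _.
  have [le_jn|lt_nj] := leqP j.+1 n.
    by rewrite (eqP (le_jn : (j.+1 - n == 0)%N)) !mulr0n mul0r mul0rn mulr0.
  (* Since [k < n <= j], the delta term of [b_t] vanishes and the induction hypothesis applies at
     [j.+1]. *)
  have jk : (j == k) = false by apply/negP => /eqP jk; rewrite jk ltnNge lt_kn in lt_nj.
  have := IH j.+1 _ _ (ltn_ord j); rewrite b_t jk add0r => e.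
  transitivity (t j * (kk j.+1 k * U N) *+ rho *+ (j.+1 - n)).
    by ring.
  rewrite e; first by ring.
    by move: lt_d (ltn_ord j) lt_nj; lia.
  exact: ltn_trans lt_kn lt_nj.
apply: (addIr (kk N k * ((\sum_j (t j * U j.+1) *+ (j.+1 - n)) *+ rho))).
by rewrite -mulrDr -e2 -e3 -mulrDl -e1.
Qed.

Lemma theta_t j : theta (t j) = (1 + t j) * (t j * U j.+1).
Proof. by rewrite -sum_b mulr_sumr; apply: eq_bigr => k _; apply: D_t. Qed.

(** With [X j] the [theta]-derivative of [t j * U j.+1], the sum of [V j * X j] is computed in two
    ways; the difference is the claim. *)
Lemma theta_W : theta W = U N * K.
Proof.
pose X j := (1 + t j) * (t j * U j.+1) * U j.+1 + t j * theta (U j.+1).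
have eX j : theta (t j * U j.+1) = X j by rewrite thetaM theta_t.
have eU n : theta (U n) = (\sum_j X j *+ minn n j.+1) *+ rho.
  rewrite {1}UE raddfD /= theta1 add0r raddfMn raddf_sum; congr (_ *+ _).
  by apply: eq_bigr => j _; rewrite raddfMn /= eX.
have eW : theta W = \sum_j X j *+ j.+1.
  by rewrite raddf_sum; apply: eq_bigr => j _; rewrite raddfMn /= eX.
(* Exchange the sums in the differentiated system for [U] and recognise the system for [V]. *)
have e1 : \sum_j t j * V j * theta (U j.+1) = \sum_j (V j - j.+1%:R) * X j.
  under eq_bigr do rewrite eU -sumrMnl mulr_sumr.
  rewrite exchange_big; apply: eq_bigr => j _.
  rewrite [V j]VE addrC addKr -sumrMnl mulr_suml; apply: eq_bigr => i _.
  by rewrite minnC; ring.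
(* Here [kk_U] at [n = j.+1] replaces [t j * V j * U j.+1] by [kk j.+1 j * U N]. *)
have e2 : \sum_j V j * X j
        = U N * K + \sum_j t j * V j * theta (U j.+1).
  rewrite /K mulr_sumr -big_split; apply: eq_bigr => j _ /=.
  have := kk_U (ltnSn j) (ltn_ord j); rewrite kk_N => e.
  transitivity ((1 + t j) * U j.+1 * (t j * V j * U j.+1)
                + t j * V j * theta (U j.+1)); first by rewrite /X; ring.
  by rewrite -e; ring.
apply: (addIr (\sum_j t j * V j * theta (U j.+1))).
rewrite -e2 eW e1 -big_split; apply: eq_bigr => j _ /=.
by ring.
Qed.

Let Q : series N rat := binom_series_quot rho.
Let F := 1 + Q *+ rho.

Lemma binom_series_r a : binom_series rho a = r a * F.
Proof.
move: a; apply: shift_rec_uniq (@binom_series_rec N rho) (shift_rec_mulr _ r_rec) _.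
by rewrite r0 mul1r binom_series0.
Qed.

(** The equations [DQ] couple all the D_j Q. Multiplying the i-th one by [U i.+1] and summing
    decouples them, as [UE] is the adjoint system. *)
Lemma theta_Q : theta Q = F * K.
Proof.
have DF k : D k F = D k Q *+ rho by rewrite raddfD raddfMn /= D1 add0r.
have DQ i : D i Q = F * ((1 + t i) * kk i.+1 i)
    + t i * (\sum_j D j Q *+ minn i.+1 j.+1) *+ rho.
  rewrite {1}/Q D_binom_series_quot !binom_series_r r0 -mulrBl -/(t i).
  rewrite /kk !mulr_sumr -sumrMnl -big_split; apply: eq_bigr => j _ /=.
  by rewrite DM D_t DF bC; ring.
have e : \sum_(i < N) U i.+1 * D i Q
    = theta Q + \sum_(i < N) U i.+1 * (t i * (\sum_j D j Q *+ minn i.+1 j.+1) *+ rho).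
  under [X in _ = _ + X]eq_bigr => i _ do
    rewrite mulr_sumr -sumrMnl mulr_sumr.
  rewrite exchange_big -big_split; apply: eq_bigr => j _ /=.
  rewrite {1}UE mulrDl mul1r -sumrMnl mulr_suml; congr (_ + _).
  apply: eq_bigr => i _; by rewrite minnC; ring.
apply: (addIr (\sum_(i < N) U i.+1 * (t i * (\sum_j D j Q *+ minn i.+1 j.+1) *+ rho))).
rewrite -e /K mulr_sumr -big_split; apply: eq_bigr => i _ /=.
by rewrite {1}DQ mulrDr; ring.
Qed.

(** By [U_N], the difference satisfies theta Y = rho K Y, so [theta_eq0] applies. *)
Lemma W_Q : W = Q.
Proof.
apply/eqP; rewrite -subr_eq0; apply/eqP; apply: (@theta_eq0 _ (K *+ rho)).
- have z0 E : theta E 0%MM = 0 by rewrite thetaE mdeg0 mul0r.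
  have -> : W = theta (\sum_j D j B *+ j.+1).
    rewrite raddf_sum; apply: eq_bigr => j _.
    by rewrite raddfMn /= -sum_b.
  by rewrite seriesBE z0 sub0r /Q /binom_series_quot eqxx oppr0.
- rewrite seriesMnE /K series_sumE big1 ?mul0rn // => j _.
  rewrite coef0M /kk series_sumE big1 ?mulr0 // => i _.
  by rewrite seriesMnE /b DE mnm0E mul0r mul0rn.
by rewrite raddfB /= theta_W theta_Q U_N /F; ring.
Qed.

(** On x^m, [theta] acts by [P_ 1 m] and sum_j (j+1) D_j by [P_ N m]. *)
Lemma coef_potential m : m != 0%MM ->
  (P_ 1 m)%:R * (P_ N m)%:R * B m = (binom_prod 'X m %/ 'X).[rho%:R].
Proof.
move=> m0; have := congr1 (fun E : series N rat => E m) W_Q.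
rewrite /Q /binom_series_quot (negPf m0) => <-.
have -> : W = theta (\sum_j D j B *+ j.+1).
  by rewrite raddf_sum; apply: eq_bigr => j _; rewrite raddfMn /= -sum_b.
rewrite thetaE series_sumE -mulrA; congr (_%:R * _).
  rewrite mdegE; apply: eq_bigr => j _.
  by rewrite (minn_idPl _) ?mul1n.
rewrite /P_ natr_sum mulr_suml; apply: eq_bigr => j _.
by rewrite (minn_idPr _) // seriesMnE DE natrM; ring.
Qed.

End DifferentialSystem.

(** * The logarithm of the Hua series *)

Section HuaRatio.
Variables g N : nat.
Implicit Types (a b m : 'X_{1..N}) (i j k : 'I_N).

Let H : series N Qq := @Hua g N.
Let L : series N Qq := fps_log H.

Definition Hua_ratio a : series N Qq := shift qX a H * sinv H.

Lemma H0 : H 0%MM = 1. Proof. exact: Hua0. Qed.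

Lemma Hua_ratio0 : Hua_ratio 0%MM = 1.
Proof. by rewrite /Hua_ratio shift0 mulr_sinv // H0. Qed.

Lemma Hua_ratio_rec b i :
  Hua_ratio (b + U_(i))%MM = Hua_ratio b +
    series_scale (qX ^+ (b i + 1 + (g - 1) * i.+1))
      (monom Qq U_(i) * Hua_ratio (b + U_(i) + hshift (2 * (g - 1)) i)%MM).
Proof.
by rewrite /Hua_ratio /H Hua_shift_rec mulrDl -series_scaleMl mulrA.
Qed.

(** Starting from [Hua_ratio 0 = 1], the recursion multiplies only by powers of q, which are regular
    at 1. *)
Lemma Hua_ratio_regular a m : exists v, has_value (Hua_ratio a m) 1 v.
Proof.
move: a m; apply: (@shift_ind _ (hshift (2 * (g - 1)))) => [m|b i m [v Hv] IH].
  by rewrite Hua_ratio0; exists ((1 : series N rat) m); apply: series_value1.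
rewrite Hua_ratio_rec seriesDE /series_scale coef_monomM.
case: ifP => [/IH[w Hw]|_]; last by exists v; rewrite mulr0 addr0.
exists (v + 1 * w); apply: has_valueD => //.
by apply: has_valueM Hw; apply: has_value_qXn.
Qed.

Lemma D_Hua_ratio k a :
  D k (Hua_ratio a) = Hua_ratio a * (shift qX a (D k L) - D k L).
Proof.
have HL : H * D k L = D k H by apply: mulr_D_log H0.
have HaL : shift qX a H * shift qX a (D k L) = D k (shift qX a H).
  by rewrite -shiftM HL D_shift.
have Hs : H * sinv H = 1 by apply: mulr_sinv H0.
have Ds : D k (sinv H) = - (D k L * sinv H).
  have e : D k H * sinv H + H * D k (sinv H) = 0 by rewrite -DM Hs D1.
  transitivity (H * sinv H * D k (sinv H)); first by rewrite Hs mul1r.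
  transitivity (sinv H * (D k H * sinv H + H * D k (sinv H))
     - sinv H * (D k H * sinv H)); first by ring.
  rewrite e mulr0 sub0r -HL.
  transitivity (- (H * sinv H * (D k L * sinv H))); first by ring.
  by rewrite Hs mul1r.
by rewrite /Hua_ratio DM -HaL Ds; ring.
Qed.

Section Limit.
Variable r : 'X_{1..N} -> series N rat.
Hypothesis Rr : forall a, series_value (Hua_ratio a) (r a).

Lemma limit0 : r 0%MM = 1.
Proof.
apply: (series_value_uniq (Rr 0%MM)); rewrite Hua_ratio0; exact: series_value1.
Qed.

Lemma limit_rec : shift_rec (hshift (2 * (g - 1))) r.
Proof.
move=> b i; apply: (series_value_uniq (Rr _)); rewrite Hua_ratio_rec.
apply: series_valueD (Rr b) _ => m; rewrite /series_scale !coef_monomM.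
rewrite -[X in has_value _ _ X]mul1r; apply: has_valueM; first exact: has_value_qXn.
by case: ifP => _; [apply: Rr | apply: (has_value_nat _ 0)].
Qed.

(** The difference is the logarithmic derivative of the regular series [Hua_ratio a], so the poles
    of the two terms cancel. *)
Lemma shift_D_L_value k a :
  series_value (shift qX a (D k L) - D k L) (sinv (r a) * D k (r a)).
Proof.
have R1 : Hua_ratio a * sinv (Hua_ratio a) = 1.
  apply: mulr_sinv; rewrite /Hua_ratio coef0M shift_at0 -coef0M mulr_sinv ?H0 //.
  by rewrite series1E eqxx.
have -> : shift qX a (D k L) - D k L = sinv (Hua_ratio a) * D k (Hua_ratio a).
  by rewrite D_Hua_ratio mulrA [sinv _ * _]mulrC R1 mul1r.
by apply: series_valueM; [apply: series_value_inv | apply: series_value_D].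
Qed.

Lemma shift_D_LE k a m :
  (shift qX a (D k L) - D k L) m = q_int (mdot a m) * (m k)%:R * ((qX - 1) * L m).
Proof.
rewrite seriesBE /shift !DE.
transitivity ((qX ^+ mdot a m - 1) * ((m k)%:R * L m)); first by ring.
by rewrite q_intE; ring.
Qed.

(** For [k] with [m k != 0], take the shift by [U_(k)]: the factor [q_int (m k) * m k] has the
    nonzero value [m k] squared at 1 and can be divided out. *)
Lemma L_regular m : exists v, has_value ((qX - 1) * L m) 1 v.
Proof.
have [->|/mnm_neq0P[k mk]] := eqVneq m 0%MM.
  exists 0; have -> : L 0%MM = 0 by rewrite /L /fps_log mdeg0 big_geq.
  by rewrite mulr0; apply: (has_value_nat _ 0).
have Hv := shift_D_L_value k U_(k) m; rewrite shift_D_LE mdot1l in Hv.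
have c0 : (m k)%:R * (m k)%:R != 0 :> rat by rewrite mulf_neq0 ?pnatr_eq0.
have := has_valueM (has_valueV c0
  (has_valueM (has_value_q_int (m k)) (has_value_nat 1 (m k)))) Hv.
rewrite mulKf; first by eexists; eauto.
rewrite mulf_neq0 ?q_int_neq0 ?lt0n //.
by case: (m k) mk => // n _; apply: Qq_nat_neq0.
Qed.

Variable B : series N rat.
Hypothesis LB : forall m, has_value ((qX - 1) * L m) 1 (B m).

(** At q = 1, [q_int (mdot a m)] becomes [mdot a m], the eigenvalue of sum_j a_j D_j at x^m. *)
Lemma limit_D a k : D k (r a) = r a * \sum_j D k (D j B) *+ a j.
Proof.
apply: (series_value_uniq (series_value_D k (Rr a))); rewrite D_Hua_ratio.
apply: series_valueM (Rr a) _ => m; rewrite shift_D_LE.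
have -> : (\sum_j D k (D j B) *+ a j) m = (mdot a m)%:R * (m k)%:R * B m.
  rewrite series_sumE /mdot natr_sum !mulr_suml; apply: eq_bigr => j _.
  by rewrite seriesMnE !DE natrM; ring.
apply: has_valueM (LB m); apply: has_valueM (has_value_nat _ _).
exact: has_value_q_int.
Qed.

End Limit.

Lemma log_Hua_value m : m != 0%MM ->
  has_value ((qX - 1) * L m) 1
    ((binom_prod 'X m %/ 'X).[(2 * (g - 1))%:R] / ((P_ 1 m)%:R * (P_ N m)%:R)).
Proof.
move=> m0.
have [r Rr] : exists r, forall a, series_value (Hua_ratio a) (r a).
  have /boolp.choice[r Rr] := fun a => series_value_exists (Hua_ratio_regular a).
  by exists r.
have [B LB] := series_value_exists (F := fun m => (qX - 1) * L m) (L_regular Rr).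
have <- := coef_potential (limit_rec Rr) (limit0 Rr) (limit_D Rr LB) m0.
have N0 : (0 < N)%N by have [i _] := mnm_neq0P m0; apply: leq_ltn_trans (ltn_ord i).
by rewrite [X in has_value _ _ X]mulrC mulKf // mulf_neq0 // pnatr_eq0 -lt0n P_gt0.
Qed.

(** Since psi_d sends [q - 1] to [(q - 1) * q_int d], moving [q - 1] inside psi_d costs a factor
    with value [1/d]: hence the square of [d] in [weight]. *)
Lemma psi_log_Hua_value d m : (0 < d)%N -> m != 0%MM -> mnm_dvd d m ->
  has_value ((moebius d)%:~R / d%:R * ((qX - 1) * fps_psi d L m)) 1
    (weight m d * (binom_prod 'X (mnm_div m d) %/ 'X).[(2 * (g - 1))%:R]).
Proof.
move=> d0 m0 dm; rewrite /fps_psi dm; set n := mnm_div m d.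
have n0 : n != 0%MM.
  apply: contra_neq m0 => e; apply/mnmP => i; move/forallP: dm => /(_ i).
  by move/divnK <-; move/mnmP: e => /(_ i); rewrite !mnmE => ->.
have dnz : d%:R != 0 :> rat by rewrite pnatr_eq0 -lt0n.
have -> : (qX - 1) * subst_q d (L n) = (q_int d)^-1 * subst_q d ((qX - 1) * L n).
  have {2}-> : qX - 1 = polyQq ('X - 1) by rewrite /polyQq rmorphB rmorph1.
  rewrite subst_q_mul_polyQq // polyQq_X1 q_intE; move: (subst_q _ _) => E.
  transitivity ((q_int d)^-1 * q_int d * ((qX - 1) * E)); last by ring.
  by rewrite mulVf ?mul1r // q_int_neq0.
set v := (X in weight m d * X).
have -> : weight m d * v = (moebius d)%:~R / d%:R *
    (d%:R^-1 * (v / ((P_ 1 n)%:R * (P_ N n)%:R))).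
  by rewrite /weight -/n div1r expr2 invfM; ring.
apply: has_valueM.
  by apply: has_valueM (has_value_int _ _) (has_valueV dnz (has_value_nat _ _)).
apply: has_valueM (has_valueV dnz (has_value_q_int d)) _.
by apply: has_value_subst d0 _; apply: log_Hua_value.
Qed.

Lemma A_mnm_value m : m != 0%MM ->
  has_value (A_mnm g m) 1 (rhs (2 * (g - 1))%:R m).
Proof.
move=> m0; rewrite -rhs_polyE // /rhs_poly horner_sum /A_mnm /fps_Log mulr_sumr.
(* The divisibility condition moves into the summand, so that both sums run over the same [d]. *)
rewrite big_nat [X in has_value _ _ X]big_nat_cond -/L.
rewrite [X in has_value _ _ X](eq_bigl
  (fun d => (0 < d < (mdeg m).+1)%N && mnm_dvd d m)) //.
rewrite [X in has_value _ _ X]big_mkcondr /=.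
apply: has_value_sum => d /andP[d0 _]; rewrite mulrCA.
case: ifPn => dm; first by rewrite hornerZ; apply: psi_log_Hua_value.
by rewrite /fps_psi (negPf dm) !mulr0; apply: (has_value_nat _ 0).
Qed.

End HuaRatio.

Lemma multiplicities_neq0 la :
  is_partition la -> la <> [::] -> multiplicities la != 0%MM.
Proof.
case: la => [//|p la] /andP[_]; rewrite inE negb_or eq_sym => /andP[p0 _] _.
(* The variable with index [p.-1] records the multiplicity of the largest part [p], which occurs. *)
have lt : (p.-1 < largest_part (p :: la))%N by rewrite /= prednK // lt0n.
apply/eqP => /mnmP/(_ (Ordinal lt)); rewrite mnm0E mnmE /= prednK ?lt0n //.
by rewrite eqxx.
Qed.

Theorem theorem1p0p1 (g : nat) (la : seq nat)
    (g_ge1 : (1 <= g)%N) (la_part : is_partition la) (la_neq0 : la <> [::]) :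
  has_value (A_part g la) 1 (rhs (2 * g%:R - 2) (multiplicities la)).
Proof.
have -> : 2 * g%:R - 2 = (2 * (g - 1))%:R :> rat.
  by rewrite natrM natrB // mulrBr mulr1.
exact/A_mnm_value/multiplicities_neq0.
Qed.
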